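(* Let $R$ be a commutative ring with identity and let $M$ be a nonzero unital $R$-module. Let $R(+)M$ denote the idealization of $M$ in $R$. The following are equivalent: (1) $R(+)M$ is a UFR. (2) $R$ is quasi-local with unique maximal ideal $\mathfrak{m}$, $\mathfrak{m}^2=0$, and $\mathfrak{m}M=0$. (3) $R$ is quasi-local with unique maximal ideal $\mathfrak{m}$, $\mathfrak{m}^2=0$, and $M$ is a semisimple $R$-module. (4) $R(+)M$ is présimplifiable and every nonzero nonunit element of $R(+)M$ is an atom.
   Context: All rings are commutative with identity and all modules are unital. The idealization $R(+)M$ of an $R$-module $M$ is the ring with underlying set $R\times M$, componentwise addition, and multiplication $(r_1,x_1)(r_2,x_2)=(r_1r_2,\ r_1x_2+r_2x_1)$. A ring is quasi-local if it has exactly one maximal ideal (no Noetherian hypothesis). A module is semisimple if it is the sum (equivalently, direct sum) of its simple submodules. Let $A$ be a ring. Elements $a,b\in A$ are associates, written $a\sim b$, if $\langle a\rangle=\langle b\rangle$ (they generate the same principal ideal). A nonunit $a\in A$ is irreducible, or an atom, if whenever $a=bc$ with $b,c\in A$, then $a\sim b$ or $a\sim c$. The ring $A$ is présimplifiable if whenever $a=ab$ with $a,b\in A$, then $a=0$ or $b$ is a unit. The ring $A$ is a UFR if every nonzero nonunit element of $A$ can be written as a product of atoms and this factorization is unique up to order and associates (that is, any two factorizations of the element into atoms have the same number of factors, and after reordering the corresponding factors are associates). *)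

(* Defs.v *)
(* Submodules and ideals are Prop-valued sets (set T := T -> Prop), so that no
   decidability is assumed; an ideal of R is a submodule of R^o. The base rings
   are comPzRingType, i.e. the zero ring is not excluded. *)
From HB Require Import structures.
From mathcomp Require Import all_boot all_algebra.
From mathcomp Require Import boolp classical_sets.

Set Implicit Arguments.
Unset Strict Implicit.
Unset Printing Implicit Defensive.

Import GRing.Theory.
Local Open Scope ring_scope.
Local Open Scope classical_set_scope.

Section Submodules.
Variables (R : comPzRingType) (V : lmodType R).

Definition submodule (N : set V) : Prop := GRing.submod_closed [in N].

Definition submod_span (X : set V) : set V := smallest submodule X.

Definition simple_submodule (N : set V) : Prop :=
  [/\ submodule N, N <> [set 0] &
      forall L : set V, submodule L -> L `<=` N -> L = [set 0] \/ L = N].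

(* The sum of a family of submodules is the submodule spanned by its union. *)
Definition semisimple : Prop :=
  submod_span (\bigcup_(N in [set N | simple_submodule N]) N) = [set: V].

(* The submodule I V of finite sums of products a *: x with a in I and x in N;
   with V := R^o it is the product of two ideals of R. *)
Definition smul_submod (I : set R) (N : set V) : set V :=
  submod_span [set a *: x | a in I & x in N].

End Submodules.

Section Rings.
Variable A : comPzRingType.
Implicit Types (a b c : A) (I J m : set A).

Definition ideal I : Prop := submodule (I : set A^o).

Definition ideal_span (X : set A) : set A := submod_span (X : set A^o).

Definition ideal_mul I J : set A := smul_submod I (J : set A^o).

Definition maximal_ideal m : Prop :=
  [/\ ideal m, m <> setT &
      forall J, ideal J -> m `<=` J -> J = m \/ J = setT].

(* m is the unique maximal ideal of A. *)
Definition quasi_local_with m : Prop :=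
  maximal_ideal m /\ forall n : set A, maximal_ideal n -> n = m.

(* A carries no decidable unit predicate, so GRing.unit is not available. *)
Definition is_unit a : Prop := exists b, a * b = 1.

Definition associates a b : Prop := ideal_span [set a] = ideal_span [set b].

Definition atom a : Prop :=
  ~ is_unit a /\
  forall b c, a = b * c -> associates a b \/ associates a c.

Definition presimplifiable : Prop :=
  forall a b, a = a * b -> a = 0 \/ is_unit b.

Definition atomic_factorization a (s : seq A) : Prop :=
  (forall x, x \in s -> atom x) /\ a = \prod_(x <- s) x.

Definition same_factorization (s t : seq A) : Prop :=
  exists t' : seq A,
    [/\ perm_eq t' t, size s = size t' &
        forall i, (i < size s)%N -> associates s`_i t'`_i].

Definition UFR : Prop :=
  forall a, a <> 0 -> ~ is_unit a ->
    (exists s, atomic_factorization a s) /\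
    (forall s t, atomic_factorization a s -> atomic_factorization a t ->
       same_factorization s t).

End Rings.

Arguments semisimple {R} V.

(* The alias keeps this ring structure apart from the componentwise
   multiplication on pairs. *)
Definition idealization (R : comPzRingType) (M : lmodType R) : Type :=
  (R * M)%type.

Section Idealization.
Variables (R : comPzRingType) (M : lmodType R).
Local Notation A := (idealization M).

HB.instance Definition _ := GRing.Zmodule.copy A (R * M)%type.

Definition idealization_one : A := (1, 0).

Definition idealization_mul (u v : A) : A :=
  (u.1 * v.1, u.1 *: v.2 + v.1 *: u.2).

Fact idealization_mulA : associative idealization_mul.
Proof.
move=> [a x] [b y] [c z]; rewrite /idealization_mul /=; congr (_, _).
  exact: mulrA.
by rewrite !scalerDr !scalerA addrA (mulrC c a) (mulrC c b).
Qed.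

Fact idealization_mulC : commutative idealization_mul.
Proof.
by move=> [a x] [b y]; rewrite /idealization_mul /= mulrC addrC.
Qed.

Fact idealization_mul1 : left_id idealization_one idealization_mul.
Proof.
by move=> [a x]; rewrite /idealization_mul /= mul1r scale1r scaler0 addr0.
Qed.

Fact idealization_mulDl : left_distributive idealization_mul +%R.
Proof.
move=> [a x] [b y] [c z]; rewrite /idealization_mul /=; congr (_, _).
  exact: mulrDl.
by rewrite scalerDl scalerDr addrACA.
Qed.

HB.instance Definition _ := GRing.Zmodule_isComPzRing.Build A
  idealization_mulA idealization_mulC idealization_mul1 idealization_mulDl.

End Idealization.

(* Main.v *)
(** Write A = R(+)M. In a UFR, factorizations can be cancelled: u v = u w <> 0
    forces v ~ w. If a is a nonunit of R and a x <> 0, then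
    (0, x)(a, 0) = (0, x)(a, z) for every z, hence (a, z) ~ (a, 0) and M = a M;
    but then (0, x) = (a, 0)^n (0, x_n) has arbitrarily long factorizations.
    So the nonunits of R are exactly the annihilator of M, which makes R
    quasi-local; and if a b <> 0 for nonunits a and b, then
    (a, 0)(b, 0) = (a, 0)(b, z) gives M = b M = 0. The remaining implications
    rest on the fact that, as soon as m^2 = 0 and m M = 0, the product of any
    two nonunits of A vanishes. As m^2 = 0, the elements 1 - x with x in m are
    invertible, so nonunits lie in m without any appeal to Zorn's lemma. *)
Require Import Defs.
From HB Require Import structures.
From mathcomp Require Import all_boot all_algebra.
From mathcomp Require Import boolp classical_sets.

Import GRing.Theory.
Local Open Scope ring_scope.
Local Open Scope classical_set_scope.

(** * Submodules, spans and products of ideals *)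

Lemma submoduleP {R : comPzRingType} {V : lmodType R} (N : set V) :
  submodule N <-> N 0 /\ forall a u v, N u -> N v -> N (a *: u + v).
Proof.
split=> [[N0 Nlin]|[N0 Nlin]].
  split=> [|a u v Nu Nv]; first exact: set_mem N0.
  by apply: set_mem; apply: Nlin; apply: mem_set.
split=> [|a u v Nu Nv]; first exact: mem_set.
by apply: mem_set; apply: Nlin; apply: set_mem.
Qed.

Lemma submodule_span {R : comPzRingType} {V : lmodType R} (X : set V) :
  submodule (submod_span X).
Proof.
apply/submoduleP; split=> [N [/submoduleP[N0 _] _]//|a u v Xu Xv N [subN XN]].
by have /submoduleP[_ Nlin] := subN; apply: Nlin; [apply: Xu|apply: Xv].
Qed.

Lemma submod_span_sub {R : comPzRingType} {V : lmodType R} (X N : set V) :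
  submodule N -> X `<=` N -> submod_span X `<=` N.
Proof. by move=> subN XN x; apply. Qed.

Lemma submodule0 {R : comPzRingType} {V : lmodType R} :
  submodule ([set 0] : set V).
Proof.
by apply/submoduleP; split=> [//|a u v /= -> ->]; rewrite scaler0 addr0.
Qed.

Lemma submoduleZ {R : comPzRingType} {V : lmodType R} (N : set V) a u :
  submodule N -> N u -> N (a *: u).
Proof.
by move=> /submoduleP[N0 Nlin] Nu; rewrite -[_ *: _]addr0; apply: Nlin.
Qed.

Lemma submodule_eq0 {R : comPzRingType} {V : lmodType R} (N : set V) :
  submodule N -> (forall u, N u -> u = 0) -> N = [set 0].
Proof.
by move=> /submoduleP[N0 _] NE; apply/seteqP; split=> [u /NE|_ ->].
Qed.

Lemma submodule_cycle {R : comPzRingType} {V : lmodType R} (x : V) :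
  submodule (range (fun r : R => r *: x)).
Proof.
apply/submoduleP; split=> [|a _ _ [r _ <-] [s _ <-]].
  by exists 0; rewrite ?scale0r.
by exists (a * r + s); rewrite // scalerDl scalerA.
Qed.

Lemma submodule_scale {R : comPzRingType} {V : lmodType R} (a : R) (N : set V) :
  submodule N -> submodule [set a *: x | x in N].
Proof.
move=> /submoduleP[N0 Nlin].
apply/submoduleP; split=> [|c _ _ [u Nu <-] [v Nv <-]].
  by exists 0; rewrite ?scaler0.
exists (c *: u + v); first exact: Nlin.
by rewrite scalerDr !scalerA mulrC.
Qed.

(** As 0 is a submodule, a span vanishes once its generators do. This turns m^2 = 0 and m M = 0 into
    conditions on elements. *)
Lemma smul_submod_eq0 {R : comPzRingType} {V : lmodType R}
    (I : set R) (N : set V) :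
  smul_submod I N = [set 0] <-> forall a x, I a -> N x -> a *: x = 0.
Proof.
split=> [IN0 a x Ia Nx|IN0].
  suff : smul_submod I N (a *: x) by rewrite IN0.
  by move=> L [_]; apply; exists a => //; exists x.
apply: submodule_eq0; first exact: submodule_span.
apply: (submod_span_sub _ _ submodule0) => _ [a Ia [x Nx <-]] /=.
exact: IN0.
Qed.

Lemma ideal_mul_eq0 {A : comPzRingType} (I J : set A) :
  ideal_mul I J = [set 0] <-> forall a b, I a -> J b -> a * b = 0.
Proof. exact: (smul_submod_eq0 I (J : set A^o)). Qed.

(** * Units and associates *)

Lemma unit_mull {A : comPzRingType} (a b : A) : is_unit (a * b) -> is_unit a.
Proof. by move=> [c]; rewrite -mulrA; exists (b * c). Qed.

Lemma unit_mulr {A : comPzRingType} (a b : A) : is_unit (a * b) -> is_unit b.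
Proof. by rewrite mulrC; apply: unit_mull. Qed.

Lemma unit1 {A : comPzRingType} : is_unit (1 : A).
Proof. by exists 1; rewrite mulr1. Qed.

Lemma mem_ideal_span1 {A : comPzRingType} (a x : A) :
  ideal_span [set a] x <-> exists r, x = r * a.
Proof.
split=> [|[r ->]]; last first.
  apply: (submoduleZ (ideal_span [set a] : set A^o) r (a : A^o)).
    exact: submodule_span.
  by move=> N [_]; apply.
move/(submod_span_sub _ _ (submodule_cycle (a : A^o))).
case=> [_ -> | r _ <-]; last by exists r.
by exists 1 => //; rewrite scale1r.
Qed.

Lemma associatesP {A : comPzRingType} (a b : A) :
  associates a b <-> (exists r, a = r * b) /\ (exists s, b = s * a).
Proof.
split=> [ab|[[r ar] [s bs]]].
  split; apply/mem_ideal_span1.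
    by rewrite -ab; apply/mem_ideal_span1; exists 1; rewrite mul1r.
  by rewrite ab; apply/mem_ideal_span1; exists 1; rewrite mul1r.
apply/seteqP; split=> x /mem_ideal_span1[c ->]; apply/mem_ideal_span1.
  by exists (c * r); rewrite -mulrA -ar.
by exists (c * s); rewrite -mulrA -bs.
Qed.

Lemma associates_mul {A : comPzRingType} (a b c d : A) :
  associates a b -> associates c d -> associates (a * c) (b * d).
Proof.
move=> /associatesP[[r ->] [s bs]] /associatesP[[t ->] [v dv]].
apply/associatesP; split; first by exists (r * t); rewrite mulrACA.
by exists (s * v); rewrite mulrACA -bs -dv.
Qed.

Lemma associates_mul_unit {A : comPzRingType} (a b : A) :
  is_unit b -> associates (a * b) a.
Proof.
move=> [c bc1]; apply/associatesP; split; first by exists b; rewrite mulrC.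
by exists c; rewrite mulrC -mulrA bc1 mulr1.
Qed.

(** * Factorizations into atoms and cancellation *)

Lemma atomic_factorization_cat {A : comPzRingType} (a b : A) s t :
  atomic_factorization a s -> atomic_factorization b t ->
  atomic_factorization (a * b) (s ++ t).
Proof.
move=> [sP ->] [tP ->]; split; last by rewrite big_cat.
by move=> x; rewrite mem_cat => /orP[/sP|/tP].
Qed.

(** Passing to the multiset of principal ideals absorbs the reordering and the associates, so that
    common factors can be cancelled with [perm_cat2l]. *)
Lemma same_factorization_perm {A : comPzRingType} (s t : seq A) :
  same_factorization s t ->
  perm_eq [seq ideal_span [set x] | x <- s] [seq ideal_span [set x] | x <- t].
Proof.
move=> [t' [t't szst st']].
suff -> : [seq ideal_span [set x] | x <- s] = [seq ideal_span [set x] | x <- t'].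
  exact: perm_map.
apply: (@eq_from_nth _ set0) => [|i]; rewrite !size_map // => lti.
by rewrite !(nth_map 0) -?szst //; apply: st'.
Qed.

Lemma associates_prod {A : comPzRingType} (s t : seq A) :
  perm_eq [seq ideal_span [set x] | x <- s] [seq ideal_span [set x] | x <- t] ->
  associates (\prod_(x <- s) x) (\prod_(x <- t) x).
Proof.
elim: s t => [|x s IHs] t st.
  by case: t st => // y t /perm_size.
have /mapP[y yt xy] : ideal_span [set x] \in [seq ideal_span [set z] | z <- t].
  by rewrite -(perm_mem st) mem_head.
have tE := perm_to_rem yt.
rewrite (perm_big _ tE) /= !big_cons; apply: associates_mul => //.
apply: IHs; rewrite -(perm_cons (ideal_span [set x])) {2}xy.
by apply: (perm_trans st); apply: (perm_map (fun z => ideal_span [set z]) tE).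
Qed.

(** Extend one factorization of a by factorizations of b and of c: both results factor a b, and
    removing the common part leaves the same principal ideals for b and c. *)
Lemma UFR_cancel {A : comPzRingType} (a b c : A) :
  UFR A -> ~ is_unit a -> ~ is_unit b -> ~ is_unit c ->
  a * b <> 0 -> a * b = a * c -> associates b c.
Proof.
move=> ufr Ua Ub Uc ab0 abc.
have factor (x y : A) : x * y <> 0 -> ~ is_unit y ->
    exists s, atomic_factorization y s.
  move=> xy0 Uy; have y0 : y <> 0 by move=> y0; rewrite y0 mulr0 in xy0.
  exact: (ufr y y0 Uy).1.
have [s sa] : exists s, atomic_factorization a s.
  by apply: (factor b) => //; rewrite mulrC.
have [t tb] := factor a b ab0 Ub.
have [u uc] : exists u, atomic_factorization c u.
  by apply: (factor a) => //; rewrite -abc.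
have Uab : ~ is_unit (a * b) by move/unit_mull.
have stab := atomic_factorization_cat _ _ _ _ sa tb.
have suab := atomic_factorization_cat _ _ _ _ sa uc.
rewrite -abc in suab.
have := same_factorization_perm _ _ ((ufr _ ab0 Uab).2 _ _ stab suab).
rewrite !map_cat perm_cat2l tb.2 uc.2; exact: associates_prod.
Qed.

(* [(r, x)] alone would be typed, and multiplied, in the product [R * M]. *)
Definition ipair {R : comPzRingType} {M : lmodType R} (r : R) (x : M) :
  idealization M := (r, x).

(** * Consequences of unique factorization in R(+)M *)

Lemma idealization_unit {R : comPzRingType} {M : lmodType R}
    (u : idealization M) :
  is_unit u <-> is_unit u.1.
Proof.
split=> [[v [uv1 _]]|[c uc1]]; first by exists v.1.
exists (c, - c *: (c *: u.2)); congr (_, _) => //=.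
by rewrite scalerA mulrN uc1 scaleN1r addNr.
Qed.

Lemma UFR_scale_eq0 {R : comPzRingType} {M : lmodType R} (a : R) (x : M) :
  UFR (idealization M) -> ~ is_unit a -> a *: x = 0.
Proof.
move=> ufr Ua; apply: contrapT => ax0.
(* Since a x <> 0, R is not the zero ring, so every (0, y) is a nonunit. *)
have R10 : ~ is_unit (0 : R).
  move=> [b]; rewrite mul0r => R01.
  by apply: ax0; rewrite -[x]scale1r -R01 scale0r scaler0.
(* Cancelling (0, x) gives (a, z) = (r, w)(a, 0), whose second component is z = a w. *)
have Ma (z : M) : exists w, z = a *: w.
  have E : ipair 0 x * ipair a 0 = ipair 0 x * ipair a z.
    by congr (_, _) => /=; rewrite !scale0r.
  have : associates (ipair a 0) (ipair a z).
    apply: UFR_cancel E => //; try by move/idealization_unit.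
    by move=> [_] /=; rewrite scale0r add0r.
  move=> /associatesP[_ [[r w] [_ ->]]].
  by exists w; rewrite /= scaler0 add0r.
(* Write (0, y) = (a, 0)(0, w). A factorization of the nonunit (a, 0) is nonempty, so by uniqueness
   (0, w) has a strictly shorter factorization than (0, y), to which induction applies. *)
have long n (y : M) s : (size s < n)%N -> y <> 0 ->
    ~ atomic_factorization (ipair 0 y) s.
  elim: n y s => // n IHn y s; rewrite ltnS => szs y0 sy.
  have [w yE] := Ma y.
  have w0 : w <> 0 by move=> w0; apply: y0; rewrite yE w0 scaler0.
  have Uw : ~ is_unit (ipair 0 w) by move/idealization_unit.
  have [|t tw] := (ufr (ipair 0 w) _ Uw).1; first by case.
  have Ua0 : ~ is_unit (ipair a (0 : M)) by move/idealization_unit.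
  have [|u ua] := (ufr (ipair a 0) _ Ua0).1.
    by case=> a0; apply: ax0; rewrite a0 scale0r.
  have := atomic_factorization_cat _ _ _ _ ua tw.
  have -> : ipair a 0 * ipair 0 w = ipair 0 y.
    by congr (_, _) => /=; rewrite ?mulr0 // scale0r addr0 -yE.
  have Uy : ~ is_unit (ipair 0 y) by move/idealization_unit.
  have [|_ uniq_y] := ufr (ipair 0 y) _ Uy; first by case.
  move=> /(uniq_y _ _ sy)/same_factorization_perm/perm_size.
  rewrite !size_map size_cat => szE.
  apply: (IHn w t) => //; apply: leq_trans szs; rewrite szE.
  case: u ua {szE} => [[_ a1]|b u _]; last by rewrite addSn ltnS leq_addl.
  by case: Ua0; rewrite a1 big_nil; apply: unit1.
have x0 : x <> 0 by move=> x0; apply: ax0; rewrite x0 scaler0.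
have Ux : ~ is_unit (ipair 0 x) by move/idealization_unit.
have [|s sx] := (ufr (ipair 0 x) _ Ux).1; first by case.
exact: long _ _ _ (ltnSn _) x0 sx.
Qed.

Lemma UFR_mul_nonunits {R : comPzRingType} {M : lmodType R} (a b : R) :
  UFR (idealization M) -> (exists x : M, x <> 0) ->
  ~ is_unit a -> ~ is_unit b -> a * b = 0.
Proof.
move=> ufr [z z0] Ua Ub; apply: contrapT => ab0; apply: z0.
(* The second components agree because a kills M. After cancellation z = b w, which vanishes because
   b kills M too. *)
have E : ipair a 0 * ipair b 0 = ipair a 0 * ipair b z.
  by congr (_, _) => /=; rewrite !(UFR_scale_eq0 a _ ufr Ua).
have : associates (ipair b 0) (ipair b z).
  apply: UFR_cancel E => //; try by move/idealization_unit.
  by case.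
move=> /associatesP[_ [[r w] [_ ->]]].
by rewrite /= scaler0 add0r (UFR_scale_eq0 b _ ufr Ub).
Qed.

(** * Maximal ideals and simple submodules *)

Lemma ideal_unit {R : comPzRingType} (I : set R) a :
  ideal I -> is_unit a -> I a -> I = setT.
Proof.
move=> idI [b ab1] Ia; apply/seteqP; split=> // x _.
rewrite -[x]mulr1 -ab1 (mulrC a) mulrA.
exact: (submoduleZ (I : set R^o) (x * b) (a : R^o)).
Qed.

(** A proper ideal contains no unit, hence lies in m. *)
Lemma quasi_local_nonunits {R : comPzRingType} (m : set R) :
  ideal m -> (forall a, m a <-> ~ is_unit a) -> quasi_local_with m.
Proof.
move=> idm mE.
have proper I : ideal I -> I <> setT -> I `<=` m.
  by move=> idI IT a Ia; apply/mE => Ua; apply: IT; apply: ideal_unit Ua Ia.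
have mT : m <> setT.
  by move=> mT; have /mE : m 1 by [rewrite mT]; case; apply: unit1.
split; first split=> // J idJ mJ.
  have [->|JT] := pselect (J = setT); [by right|left].
  by apply/seteqP; split=> //; apply: proper.
by move=> n [idn nT /(_ m idm (proper _ idn nT))[]].
Qed.

(** The ideal m + R a contains a, so it is strictly larger than m and contains 1. *)
Lemma maximal_comaximal {R : comPzRingType} (m : set R) a :
  maximal_ideal m -> ~ m a -> exists x r, m x /\ 1 = x + r * a.
Proof.
move=> [/submoduleP[m0 mlin] mT mmax] ma.
pose J : set R := [set y | exists x r, m x /\ y = x + r * a].
have [||JE|JT] := mmax J.
- apply/submoduleP; split=> [|c _ _ [x [r [mx ->]]] [y [s [my ->]]]].
    by exists 0, 0; rewrite mul0r addr0.
  exists (c * x + y), (c * r + s); split; first exact: mlin.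
  by rewrite [_ *: _]mulrDr mulrDl addrACA mulrA.
- by move=> x mx; exists x, 0; rewrite mul0r addr0.
- by case: ma; rewrite -JE; exists 0, 1; rewrite mul1r add0r.
by have : J 1 by rewrite JT.
Qed.

(** The vectors killed by a form a submodule, so simple submodules S suffice. There a S is 0 or S,
    and in the latter case a S = a (a S) = 0. *)
Lemma semisimple_scale_eq0 {R : comPzRingType} {M : lmodType R} (a : R) (x : M) :
  semisimple M -> a * a = 0 -> a *: x = 0.
Proof.
move=> ssM aa0.
have : submod_span (\bigcup_(N in [set N | simple_submodule N]) N) x.
  by rewrite ssM.
move: x; apply: (submod_span_sub _ [set x : M | a *: x = 0]).
  apply/submoduleP; split=> [|c u v /= au av]; first exact: scaler0.
  by rewrite scalerDr av scalerA mulrC -scalerA au scaler0 addr0.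
move=> x [S [subS S0 Smin] Sx] /=.
have sub_aS : [set a *: y | y in S] `<=` S.
  by move=> _ [y Sy <-]; apply: submoduleZ.
have [aS0|aSS] := Smin _ (submodule_scale a _ subS) sub_aS.
  have : [set a *: y | y in S] (a *: x) by exists x.
  by rewrite aS0.
by move: Sx; rewrite -{1}aSS => -[y _ <-]; rewrite scalerA aa0 scale0r.
Qed.

(** * Atoms in presimplifiable rings *)

Lemma presimplifiable_atom_prod {A : comPzRingType} (a : A) s :
  presimplifiable A -> a <> 0 -> atom a -> atomic_factorization a s ->
  s = [:: a].
Proof.
move=> psA a0 [Ua aP].
(* If b = d a, then a = a (d c), which forces d c, and with it c, to be a unit. *)
have absurd b c : a = b * c -> ~ is_unit c -> ~ associates a b.
  move=> abc Uc /associatesP[_ [d bd]].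
  have : a = a * (d * c) by rewrite mulrA (mulrC a) -bd.
  by move=> /psA[//|/unit_mulr].
case: s => [[_ a1]|p [[_ ->]|q s [sP aE]]].
- by case: Ua; rewrite a1 big_nil; apply: unit1.
- by rewrite big_seq1.
(* With at least two factors, the first one and the product of the others are both nonunits, yet the
   atom a is associate to one of them. *)
move: aE; rewrite big_cons => aE.
have Up : ~ is_unit p by apply: (sP p _).1; rewrite mem_head.
have Uq : ~ is_unit (\prod_(x <- q :: s) x).
  rewrite big_cons => /unit_mull; apply: (sP q _).1.
  by rewrite !inE eqxx orbT.
have [ap|aq] := aP _ _ aE; first by case: (absurd _ _ aE Uq).
by rewrite mulrC in aE; case: (absurd _ _ aE Up).
Qed.

Theorem theorem8 (R : comPzRingType) (M : lmodType R)
    (M_neq0 : exists x : M, x <> 0) :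
  [<-> UFR (idealization M);
       exists m : set R,
         [/\ quasi_local_with m, ideal_mul m m = [set 0] &
             smul_submod m [set: M] = [set 0]];
       exists m : set R,
         [/\ quasi_local_with m, ideal_mul m m = [set 0] & semisimple M];
       presimplifiable (idealization M) /\
         forall u : idealization M, u <> 0 -> ~ is_unit u -> atom u].
Proof.
tfae.
- move=> ufr.
  (* Nonunits kill M by cancellation; a unit killing M would make M zero. *)
  pose m : set R := [set a | forall x : M, a *: x = 0].
  have mE a : m a <-> ~ is_unit a.
    split=> [ma [b ab1]|Ua x]; last exact: UFR_scale_eq0.
    have [x] := M_neq0; apply.
    by rewrite -[x]scale1r -ab1 -scalerA ma.
  exists m; split.
  + apply: quasi_local_nonunits => //; apply/submoduleP; split=> [x|c u v mu mv x].
      exact: scale0r.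
    by rewrite scalerDl mv addr0 -scalerA mu scaler0.
  + by apply/ideal_mul_eq0 => a b /mE Ua /mE Ub; exact: (UFR_mul_nonunits a b ufr).
  + by apply/smul_submod_eq0 => a x ma _; apply: ma.
- move=> [m [qlm mm0 /smul_submod_eq0 mM0]]; exists m; split=> //.
  apply/seteqP; split=> // x _ N [submN subN].
  have [->|x0] := pselect (x = 0).
    by have /submoduleP[] := submN.
  (* As m M = 0, M is a vector space over R/m, and the line R x is simple. *)
  apply: subN; exists (range (fun r : R => r *: x)); last first.
    by exists 1; rewrite ?scale1r.
  split; first exact: submodule_cycle.
    move=> E; apply: x0; suff : range (fun r : R => r *: x) x by rewrite E.
    by exists 1; rewrite ?scale1r.
  move=> L subL Lx.
  have [[y [Ly y0]]|L0] := pselect (exists y, L y /\ y <> 0); last first.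
    left; apply: submodule_eq0 => // y Ly.
    by apply: contrapT => y0; apply: L0; exists y.
  right; apply/seteqP; split=> // _ [r _ <-]; apply: submoduleZ => //.
  (* Here y = c x <> 0, so c is not in m; from 1 = z + d c with z in m follows x = d y, which lies
     in L. *)
  have [c _ cx] := Lx _ Ly.
  have mc : ~ m c by move=> mc; apply: y0; rewrite -cx mM0.
  have [z [d [mz zd1]]] := maximal_comaximal _ _ qlm.1 mc.
  rewrite -[x]scale1r zd1 scalerDl mM0 // add0r -scalerA cx.
  exact: submoduleZ.
- move=> [m [qlm /ideal_mul_eq0 mm0 ssM]].
  have nonunit_m a : ~ is_unit a -> m a.
    move=> Ua; apply: contrapT => ma.
    have [z [d [mz zd1]]] := maximal_comaximal _ _ qlm.1 ma.
    (* Modulo m, d inverts a: d a = 1 - z, and (1 - z)(1 + z) = 1 because z^2 = 0. *)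
    apply: Ua; exists (d * (1 + z)); rewrite mulrA (mulrC a).
    have -> : d * a = 1 - z by rewrite zd1 addrAC subrr add0r.
    by rewrite mulrDr mulr1 mulrBl mul1r mm0 // subr0 subrK.
  (* The first components lie in m, so their product is 0; each also squares to 0, hence kills the
     semisimple module M. *)
  have mul0 (u v : idealization M) : ~ is_unit u -> ~ is_unit v -> u * v = 0.
    move=> Uu Uv.
    have mu : m u.1 by apply: nonunit_m => /idealization_unit.
    have mv : m v.1 by apply: nonunit_m => /idealization_unit.
    congr (_, _); first exact: mm0.
    by rewrite /= !semisimple_scale_eq0 ?addr0 //; apply: mm0.
  split=> [u v uv|u u0 Uu].
    have [Uv|Uv] := pselect (is_unit v); [by right|left].
    (* u = u v = u v^2, and v^2 = 0. *)
    by rewrite uv uv -mulrA (mul0 v v) // mulr0.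
  split=> // b c uE.
  have [Ub|Ub] := pselect (is_unit b).
    by right; rewrite uE mulrC; apply: associates_mul_unit.
  have [Uc|Uc] := pselect (is_unit c).
    by left; rewrite uE; apply: associates_mul_unit.
  by case: u0; rewrite uE mul0.
- move=> [psA atomA] u u0 Uu; have atu := atomA u u0 Uu; split.
    exists [:: u]; split; last by rewrite big_seq1.
    by move=> x; rewrite inE => /eqP ->.
  move=> s t su tu.
  (* As u is an atom, both factorizations consist of u alone. *)
  rewrite (presimplifiable_atom_prod _ _ psA u0 atu su).
  rewrite (presimplifiable_atom_prod _ _ psA u0 atu tu).
  by exists [:: u]; split.
Qed.
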